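(* Let $A,B\in B(H)$ be such that $A$ is positive and $B$ is self-adjoint. If $AB$ (or $BA$) is hyponormal, then $A+iB$ is normal.
   Context: $H$ is a complex separable Hilbert space with $\dim H=\infty$; $B(H)$ is the set of bounded linear operators on $H$. Positive means $\langle Ax,x\rangle\geq 0$ for all $x\in H$. An operator $T\in B(H)$ is hyponormal if $\|T^*x\|\leq\|Tx\|$ for all $x\in H$, and normal if $TT^*=T^*T$. *)

(* Defs.v *)
From HB Require Import structures.
From mathcomp Require Import all_boot all_order all_algebra.
From mathcomp Require Import complex.
From mathcomp Require Import boolp classical_sets functions cardinality reals.
From mathcomp Require Import topology normedtype.
From mathcomp Require Import ring lra.

Set Implicit Arguments.
Unset Strict Implicit.
Unset Printing Implicit Defensive.

Import Order.TTheory GRing.Theory Num.Theory Num.Def.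
Import numFieldNormedType.Exports.

Local Open Scope classical_set_scope.
Local Open Scope ring_scope.

HB.mixin Record isHilbert (R : realType) H & CompleteNormedModule R[i] H := {
  inner : {dot H for conjC};
  inner_normE : forall x : H, inner x x = `|x| ^+ 2
}.

#[short(type="hilbertType")]
HB.structure Definition Hilbert (R : realType) :=
  {H of CompleteNormedModule R[i] H & isHilbert R H}.

Definition separable (T : topologicalType) : Prop :=
  exists2 D : set T, countable D & dense D.

Definition finite_dimensional (K : nzRingType) (V : lmodType K) : Prop :=
  exists n (e : 'I_n -> V), forall x, exists c : 'I_n -> K,
    x = \sum_(i < n) c i *: e i.

Section Operators.
Context {R : realType} {H : hilbertType R}.
Implicit Types T : H -> H.

Definition bounded_operator T : Prop :=
  exists M, forall x, `|T x| <= M * `|x|.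

(* For T linear and bounded, such a z exists by the Riesz representation
   theorem (see adjointP below) and is unique by definiteness of inner. *)
Definition adjoint T (y : H) : H :=
  xget 0 [set z | forall x, inner (T x) y = inner x z].

Definition self_adjoint T : Prop := adjoint T = T.

(* The order of R[i] makes 0 <= z imply that z is real. *)
Definition positive T : Prop := forall x, 0 <= inner (T x) x.

Definition hyponormal T : Prop := forall x, `|adjoint T x| <= `|T x|.

Definition normal T : Prop := T \o adjoint T = adjoint T \o T.

End Operators.

Local Lemma discr (R : realFieldType) (a b c : R) : 0 <= a ->
  (forall t, 0 <= t ^+ 2 * a + 2 * t * b + c) -> b ^+ 2 <= c * a.
Proof.
move=> a0 h; have [a_eq0|a_neq0] := eqVneq a 0.
  rewrite a_eq0 mulr0; case: (eqVneq b 0) => [->|bn0]; first by rewrite expr0n.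
  have := h (- (c + 1) / (2 * b)).
  have -> : (- (c + 1) / (2 * b)) ^+ 2 * a + 2 * (- (c + 1) / (2 * b)) * b + c = -1.
    by rewrite a_eq0; field.
  by rewrite lerNr oppr0 ler10.
have ap : 0 < a by rewrite lt0r a_neq0.
have := h (- b / a).
have -> : (- b / a) ^+ 2 * a + 2 * (- b / a) * b + c = (c * a - b ^+ 2) / a by field.
by rewrite pmulr_lge0 ?invr_gt0 // subr_ge0.
Qed.

Local Lemma amgm (R : realFieldType) (a b K : R) : 0 <= a -> b ^+ 2 <= `|K| * a ->
  - `|K| <= a - 2 * b.
Proof.
move: (normr_ge0 K); move: {K}(`|K| : R) => K K0 a0 ba.
rewrite leNgt; apply/negP => ab.
have h1 : 0 < 2 * b - (a + K) by lra.
have h3 := sqr_ge0 (a - K).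
have h4 : 0 < (2 * b - (a + K)) * (2 * b + (a + K)) by rewrite mulr_gt0 //; lra.
nra.
Qed.

Local Lemma close_eq (R : realFieldType) (p q d g r e n : R) :
  0 <= n -> 0 < e ->
  e * (4 * (n + 1)) = (q + p - g) ^+ 2 -> r < e -> d < e ->
  (p - g) ^+ 2 <= r * n -> q ^+ 2 <= n * d -> False.
Proof.
move=> n0 e0 eb re de h1 h2.
have h3 := sqr_ge0 (q - (p - g)).
have h4 : r * n <= e * n by rewrite ler_wpM2r // ltW.
have h5 : n * d <= e * n by rewrite mulrC ler_wpM2r // ltW.
nra.
Qed.

Section Riesz.
Context {R : realType} {H : hilbertType R}.
Implicit Types x y z w : H.

Let N x : R := complex.Re (inner x x).
Let B x y : R := complex.Re (inner x y).

Let innerDl x y z : inner (x + y) z = inner x z + inner y z.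
Proof. by rewrite linearDl. Qed.

Let innerC x y : inner x y = conjC (inner y x).
Proof. by rewrite hermC /= expr0 mul1r. Qed.

Let innerZl a x y : inner (a *: x) y = a * inner x y.
Proof. by rewrite linearZl_LR. Qed.

Let ReC (a : R[i]) : complex.Re (conjC a) = complex.Re a.
Proof. by case: a. Qed.

Let ReD (a b : R[i]) : complex.Re (a + b) = complex.Re a + complex.Re b.
Proof. by case: a; case: b. Qed.

Let ReZ (t : R) (a : R[i]) : complex.Re (t%:C%C * a) = t * complex.Re a.
Proof. by case: a => a b /=; rewrite mul0r subr0. Qed.

Let BC x y : B x y = B y x. Proof. by rewrite /B innerC ReC. Qed.
Let BDl x y z : B (x + y) z = B x z + B y z.
Proof. by rewrite /B innerDl ReD. Qed.
Let BZl t x y : B (t%:C%C *: x) y = t * B x y.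
Proof. by rewrite /B innerZl ReZ. Qed.

Let NE x : N x = B x x. Proof. by []. Qed.

Let ND x y : N (x + y) = N x + N y + 2 * B x y.
Proof. by rewrite !NE BDl ![B _ (_ + _)]BC !BDl (BC y x); ring. Qed.
Let NZ t x : N (t%:C%C *: x) = t ^+ 2 * N x.
Proof. by rewrite !NE BZl BC BZl; ring. Qed.

Let normN x : `|x| ^+ 2 = (N x)%:C%C.
Proof.
rewrite -inner_normE /N; have : 0 <= inner x x by rewrite inner_normE exprn_ge0.
by case: (inner x x) => a b; rewrite lecE /= => /andP[/eqP -> _].
Qed.

Let N_ge0 x : 0 <= N x.
Proof. by rewrite -lecR -normN exprn_ge0. Qed.

Let CS x y : B x y ^+ 2 <= N x * N y.
Proof.
rewrite mulrC; apply: discr => // t.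
have := N_ge0 (t%:C%C *: x + y); rewrite ND NZ BZl.
by rewrite mulrA addrAC.
Qed.

Let CX (t : R) : (t ^+ 2)%:C%C = t%:C%C ^+ 2 :> R[i].
Proof. exact: rmorphXn. Qed.

Lemma riesz (f : H -> R[i]) (M : R) :
  (forall a x y, f (a *: x + y) = a * f x + f y) ->
  (forall x, complex.Re (f x) ^+ 2 <= M * complex.Re (inner x x)) ->
  exists z, forall x, f x = inner x z.
Proof.
move=> flin fM.
have f0 : f 0 = 0 by have /eqP := flin 1 0 0;
  rewrite scale1r addr0 mul1r -subr_eq0 opprD addrA subrr sub0r oppr_eq0 => /eqP.
have fD x y : f (x + y) = f x + f y by have := flin 1 x y; rewrite scale1r mul1r.
have fZ a x : f (a *: x) = a * f x by have := flin a x 0; rewrite !addr0 f0 addr0.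
clear f0.
pose g x := complex.Re (f x).
have gD x y : g (x + y) = g x + g y by rewrite /g fD ReD.
have gZ t x : g (t%:C%C *: x) = t * g x by rewrite /g fZ ReZ.
pose J x := N x - 2 * g x.
have J_lb x : - `|M| <= J x.
  have := fM x; rewrite -/(g x) -/(N x) /J.
  have := N_ge0 x; move: (N x) (g x) => a b a0 ba.
  have {}ba : b ^+ 2 <= `|M| * a by rewrite (le_trans ba) // ler_wpM2r ?ler_norm.
  exact: amgm.
pose E := [set J x | x in [set: H]].
have infE : has_inf E.
  by split; [exists (J 0), 0 | exists (- `|M|) => _ [x _ <-]].
pose m := inf E.
have mJ x : m <= J x by apply: ge_inf; [exact: infE.2 | exists x].
have /choice[u uP] : forall n : nat, exists x, J x < m + n.+1%:R^-1.
  move=> n; have [_ [x _ <-] xm] := @inf_adherent _ E n.+1%:R^-1 ltac:(by rewrite invr_gt0) infE.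
  by exists x.
have par x y : N (x - y) <= 2 * (J x - m) + 2 * (J y - m).
  have := mJ ((2^-1)%:C%C *: (x + y)).
  have -> : x - y = x + (-1)%:C%C *: y by rewrite rmorphN1 scaleN1r.
  by rewrite /J NZ gZ gD !ND NZ ![B x (_ *: _)]BC BZl (BC y x); lra.
have near_min x e w : J x < m + e -> (B w x - g w) ^+ 2 <= e * N w.
  move=> xe; apply: discr => // t.
  have := mJ (t%:C%C *: w + x); rewrite /J ND NZ BZl gD gZ.
  by move: xe; rewrite /J; lra.
have Nsmall (e : R) : 0 < e -> exists n0 : nat, forall n, (n0 <= n)%N -> n.+1%:R^-1 < e.
  move=> e0; exists (truncn e^-1) => n hn.
  rewrite invf_plt ?posrE //; apply: (lt_le_trans (truncnS_gt _)).
  by rewrite ler_nat ltnS.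
have [z uz] : exists z, u n @[n --> \oo] --> z.
  suff : cvg (u n @[n --> \oo]) by move=> /cvg_ex.
  apply: cauchy_cvg; apply/cauchy_ballP => -[e e'].
  rewrite ltcE /= => /andP[/eqP -> e0].
  have [n0 hn0] := Nsmall (e ^+ 2 / 4) ltac:(by rewrite divr_gt0 // exprn_gt0).
  exists ([set u n | n in [set n | (n0 <= n)%N]], [set u n | n in [set n | (n0 <= n)%N]]).
    by split; exists n0 => // n /= hn; exists n.
  move=> [_ _] [] /= [p hp <-] [q hq <-].
  rewrite -ball_normE /ball_ /=.
  rewrite -(@ltr_pXn2r _ 2) ?nnegrE //; last by rewrite lecR ltW.
  rewrite normN -CX ltcR.
  apply: (le_lt_trans (par _ _)).
  have := hn0 _ hp; have := hn0 _ hq; have := uP p; have := uP q.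
  move: (J (u p)) (J (u q)) (p.+1%:R^-1) (q.+1%:R^-1) (e ^+ 2) => a b c d k; lra.
exists z.
have gB w : g w = B w z.
  apply/eqP; rewrite eq_sym -subr_eq0 -sqrf_eq0 eq_le sqr_ge0 andbT.
  rewrite leNgt; apply/negP => b0; set b := _ ^+ 2 in b0.
  pose e := b / (4 * (N w + 1)).
  have Nw := N_ge0 w.
  have e0 : 0 < e by rewrite divr_gt0 // mulr_gt0 //; lra.
  have eb : e * (4 * (N w + 1)) = b by rewrite divfK // mulf_neq0 //; lra.
  have [n0 hn0] := Nsmall _ e0.
  have /cvgrPdist_lt/(_ ((Num.sqrt e)%:C%C)) := uz.
  rewrite ltcR sqrtr_gt0 => /(_ e0)[n1 _ hn1].
  pose n := maxn n0 n1.
  have h0 := hn0 n (leq_maxl _ _).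
  have /= := hn1 n (leq_maxr _ _).
  rewrite -(@ltr_pXn2r _ 2) ?nnegrE //; last by rewrite lecR sqrtr_ge0.
  rewrite normN -CX ltcR sqr_sqrtr ?ltW // => h1.
  have := near_min _ _ w (uP n).
  have := CS w (z - u n).
  have BE : B w z = B w (z - u n) + B w (u n) by rewrite -[in LHS](subrK (u n) z) BC BDl ![B _ w]BC.
  move: eb; rewrite /b BE => eb h2 h3; exact: close_eq eb h0 h1 h3 h2.
move=> x.
have : g ('i%C *: x) = B ('i%C *: x) z by [].
have := gB x; rewrite /g /B fZ innerZl.
case: (f x) (inner x z) => [a b] [a' b'] /= ->.
by rewrite !mul0r !mul1r !sub0r => /oppr_inj ->.
Qed.

Lemma adjointP (T : {linear H -> H}) : bounded_operator T ->
  forall x y, inner (T x) y = inner x (adjoint T y).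
Proof.
move=> [M TM] x y.
suff /(xgetPex (0 : H))/(_ x) :
  [set z | forall x, inner (T x) y = inner x z] !=set0 by [].
have NT w : N (T w) <= complex.Re (`|M| ^+ 2) * N w.
  have M0 : `|M| ^+ 2 = (complex.Re (`|M| ^+ 2))%:C%C.
    have : 0 <= `|M| ^+ 2 by rewrite exprn_ge0.
    by case: (_ ^+ 2) => a b; rewrite lecE /= => /andP[/eqP -> _].
  rewrite -lecR rmorphM /= -M0 -!normN -exprMn ler_pXn2r ?nnegrE ?mulr_ge0 //.
  apply: (le_trans (TM w)).
  have := le_trans (normr_ge0 _) (TM w).
  by move=> h; rewrite -(ger0_norm h) normrM normr_id.
apply: (@riesz _ (complex.Re (`|M| ^+ 2) * N y)) => [a v w|w].
  by rewrite linearP innerDl innerZl.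
apply: (le_trans (CS _ _)); rewrite mulrAC ler_wpM2r //.
Qed.

End Riesz.

(* Main.v *)
Require Import Defs.
From mathcomp Require Import all_boot all_order all_algebra.
From mathcomp Require Import complex.
From mathcomp Require Import boolp classical_sets functions cardinality reals.
From mathcomp Require Import topology normedtype.
From mathcomp Require Import ring lra.

Import Order.TTheory GRing.Theory Num.Theory Num.Def.
Import numFieldNormedType.Exports.
Local Open Scope ring_scope.

(** Since [A] and [B] are self-adjoint, [A + iB] is normal exactly when [A] and
[B] commute, that is, when [A B] equals its adjoint [B A].  So it must be shown
that a hyponormal [T], equal to [A B] or to [B A], is self-adjoint.

The spectrum of [B A] should be real, because [B A] is symmetric for the
semi-inner product <Ax, y>, and a hyponormal operator with real spectrum is
self-adjoint.  The proof extracts from this heuristic an estimate that needs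
neither a spectrum nor a square root of [A].

Upper bound ([symmetrizable_growth]): in the seminorm of <Ax, y>, the operator
[S = B A] is symmetric and bounded, hence S - i mu multiplies squared lengths by
at most r + mu^2 for every real mu, with r independent of mu.  Both choices of
[T] satisfy T K = K S for an operator [K] which the seminorm dominates: K = A
when T = A B, and K = B A when T = B A.  So the squared norm of
(T - i mu)^n K x is O((r + mu^2)^n).

Lower bound ([hyponormal_log_convex]): T - i mu is again hyponormal, so the
norms of (T - i mu)^n y are log-convex in n and grow at least as fast as their
first ratio.  Comparing the two ([log_convex_growth]) at y = K x gives
|Ty - i mu y|^2 <= (r + mu^2) |y|^2.  The terms in mu^2 cancel, and what remains
is linear in mu: hence <Ty, y> is real ([intertwined_real]).

As [K] is [A] or [T], this applies to all [y] in the range of [T].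
Decomposing the space into the closure of that range and the kernel of T^*,
hyponormality then excludes any coupling between the two summands, and [T] is
self-adjoint ([hyponormal_selfadjoint]).

The estimates use the real part of the inner product: the complex structure enters
through multiplication by i, and the reality of <z, y> is the vanishing of the
real part of <z, iy>. *)

(** * Real sequences *)

Section RealSequences.
Variable R : realType.

Lemma linear_bound_eq0 (p c K : R) : (forall m, p - m * c <= K) -> c = 0.
Proof.
move=> h; apply/eqP/negP => /negP c0.
have := h ((p - K - 1) / c); rewrite divfK //; lra.
Qed.

(** A ratio above 1 makes the powers unbounded, by Bernoulli's inequality. *)
Lemma geometric_bound (q c C : R) : 0 <= q -> 0 < c ->
  (forall n, c * q ^+ n <= C) -> q <= 1.
Proof.
move=> q0 c0 h; rewrite leNgt; apply/negP => q1.
have bern n : 1 + n%:R * (q - 1) <= q ^+ n.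
  elim: n => [|n IH]; first by rewrite mul0r addr0 expr0.
  have := ler_wpM2r q0 IH; rewrite -exprSr; apply: le_trans.
  have n0 : 0 <= n%:R :> R by [].
  have n1 : n.+1%:R = n%:R + 1 :> R by rewrite -addn1 natrD.
  rewrite n1; have := mulr_ge0 n0 (sqr_ge0 (q - 1)); nra.
have d0 : 0 < c * (q - 1) by rewrite mulr_gt0 // subr_gt0.
pose n := (truncn (C / (c * (q - 1)))).+1.
have : C / (c * (q - 1)) < n%:R by exact: truncnS_gt.
rewrite ltr_pdivrMr // => Cn.
have := h n; have := ler_wpM2l (ltW c0) (bern n); nra.
Qed.

(** Log-convexity makes the successive ratios nondecreasing, so the first one
is at most the exponential rate of growth. *)
Lemma log_convex_growth (a : nat -> R) (C rho : R) : 0 < rho ->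
  (forall n, 0 <= a n) ->
  (forall n, a n.+1 ^+ 2 <= a n * a n.+2) ->
  (forall n, a n <= C * rho ^+ n) ->
  a 1%N <= rho * a 0%N.
Proof.
move=> rho0 a_ge0 a_conv a_bnd.
have [a0|a0] := eqVneq (a 0%N) 0.
  have := a_conv 0%N; rewrite a0 mul0r mulr0 => h.
  have /eqP : a 1%N ^+ 2 = 0 by apply/eqP; rewrite eq_le h sqr_ge0.
  by rewrite sqrf_eq0 => /eqP ->.
have {}a0 : 0 < a 0%N by rewrite lt0r a0 a_ge0.
pose q := a 1%N / a 0%N.
have q0 : 0 <= q by rewrite divr_ge0.
have ratio n : q * a n <= a n.+1.
  elim: n => [|n IH]; first by rewrite /q divfK ?gt_eqF.
  have [an|an] := eqVneq (a n.+1) 0; first by rewrite an mulr0.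
  have {}an : 0 < a n.+1 by rewrite lt0r an a_ge0.
  rewrite -(ler_pM2r an) -mulrA -expr2.
  apply: (le_trans (ler_wpM2l q0 (a_conv n))).
  rewrite mulrA mulrC; apply: ler_wpM2l => //.
have growth n : a 0%N * q ^+ n <= a n.
  elim: n => [|n IH]; first by rewrite mulr1.
  by apply: le_trans (ratio n); rewrite exprS mulrCA; apply: ler_wpM2l.
have : q / rho <= 1.
  apply: (@geometric_bound _ (a 0%N) C) => //; first by rewrite divr_ge0 // ltW.
  move=> n; rewrite expr_div_n mulrA ler_pdivrMr ?exprn_gt0 //.
  exact: le_trans (growth n) (a_bnd n).
by rewrite ler_pdivrMr // mul1r /q ler_pdivrMr.
Qed.

End RealSequences.

(** * The real part of the inner product *)

Section RealInnerProduct.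
Context {R : realType} {H : hilbertType R}.
Implicit Types (x y z : H) (T S A K : {linear H -> H}).

Definition rdot x y : R := complex.Re (inner x y).
Definition nrm2 x : R := rdot x x.

Definition adjoint_pair (T S : H -> H) := forall x y, rdot (T x) y = rdot x (S y).

Lemma innerC x y : inner x y = conjC (inner y x).
Proof. by rewrite hermC /= expr0 mul1r. Qed.

Lemma innerZl a x y : inner (a *: x) y = a * inner x y.
Proof. by rewrite linearZl_LR. Qed.

Lemma rdotC x y : rdot x y = rdot y x.
Proof. by rewrite /rdot innerC; case: (inner y x). Qed.

Lemma rdotDl x y z : rdot (x + y) z = rdot x z + rdot y z.
Proof.
have ReD (a b : R[i]) : complex.Re (a + b) = complex.Re a + complex.Re b.
  by case: a; case: b.
by rewrite /rdot linearDl ReD.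
Qed.

Lemma rdotZl (t : R) x y : rdot (t%:C%C *: x) y = t * rdot x y.
Proof. by rewrite /rdot innerZl; case: (inner x y) => a b /=; rewrite mul0r subr0. Qed.

Lemma rdotDr x y z : rdot x (y + z) = rdot x y + rdot x z.
Proof. by rewrite !(rdotC x) rdotDl. Qed.

Lemma rdotZr (t : R) x y : rdot x (t%:C%C *: y) = t * rdot x y.
Proof. by rewrite !(rdotC x) rdotZl. Qed.

Lemma rdotNl x y : rdot (- x) y = - rdot x y.
Proof. by have := rdotZl (-1) x y; rewrite rmorphN1 scaleN1r mulN1r. Qed.

Lemma rdotNr x y : rdot x (- y) = - rdot x y.
Proof. by rewrite !(rdotC x) rdotNl. Qed.

Lemma rdot0r x : rdot x 0 = 0.
Proof. by have := rdotZr 0 x 0; rewrite scaler0 mul0r. Qed.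

Lemma rdot0l x : rdot 0 x = 0.
Proof. by rewrite rdotC rdot0r. Qed.

Definition rdotE := (rdotDl, rdotDr, rdotZl, rdotZr, rdotNl, rdotNr).

Lemma rdot_il x y : rdot ('i%C *: x) y = - rdot x ('i%C *: y).
Proof.
rewrite (rdotC x) /rdot !innerZl (innerC x).
by case: (inner y x) => a b /=; rewrite !mul0r !mul1r; ring.
Qed.

Lemma iiE x : 'i%C *: ('i%C *: x) = - x.
Proof. by rewrite scalerA -expr2 complexiE sqrCi scaleN1r. Qed.

Lemma normE x : `|x| ^+ 2 = (nrm2 x)%:C%C.
Proof.
rewrite -inner_normE /nrm2 /rdot; have : 0 <= inner x x by rewrite inner_normE exprn_ge0.
by case: (inner x x) => a b; rewrite lecE /= => /andP[/eqP -> _].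
Qed.

Lemma nrm2_ge0 x : 0 <= nrm2 x.
Proof. by rewrite -lecR -normE exprn_ge0. Qed.

Lemma nrm2_eq0 x : nrm2 x = 0 -> x = 0.
Proof.
move=> x0; have := normE x; rewrite x0 => /eqP.
by rewrite sqrf_eq0 normr_eq0 => /eqP.
Qed.

Lemma le_nrm2 x y : (`|x| <= `|y|) = (nrm2 x <= nrm2 y).
Proof. by rewrite -lecR -!normE ler_pXn2r ?nnegrE. Qed.

Lemma rdot_inj x y : (forall z, rdot z x = rdot z y) -> x = y.
Proof.
move=> h; apply/eqP; rewrite -subr_eq0; apply/eqP/nrm2_eq0.
by rewrite /nrm2 !rdotDr !rdotNr !h subrr.
Qed.

Lemma bounded_nrm2 (T : H -> H) : bounded_operator T ->
  exists2 m : R, 0 <= m & forall x, nrm2 (T x) <= m * nrm2 x.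
Proof.
move=> [M TM]; exists (complex.Re (`|M| ^+ 2)).
  have : 0 <= `|M| ^+ 2 by rewrite exprn_ge0.
  by case: (_ ^+ 2) => a b; rewrite lecE /= => /andP[_].
have M0 : `|M| ^+ 2 = (complex.Re (`|M| ^+ 2))%:C%C.
  have : 0 <= `|M| ^+ 2 by rewrite exprn_ge0.
  by case: (_ ^+ 2) => a b; rewrite lecE /= => /andP[/eqP -> _].
move=> x; rewrite -lecR rmorphM /= -M0 -!normE -exprMn.
rewrite ler_pXn2r ?nnegrE ?mulr_ge0 //.
apply: (le_trans (TM x)); have := le_trans (normr_ge0 _) (TM x).
by move=> h; rewrite -(ger0_norm h) normrM normr_id.
Qed.

(** Agreement of real parts suffices, because replacing [x] by i x turns the
imaginary parts into real parts. *)
Lemma adjoint_pair_inner T (S : H -> H) : adjoint_pair T S ->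
  forall x y, inner (T x) y = inner x (S y).
Proof.
move=> TS x y; have := TS x y; have := TS ('i%C *: x) y.
rewrite linearZ_LR /rdot !innerZl.
case: (inner (T x) y) (inner x (S y)) => [a b] [c d] /=.
by rewrite !mul0r !mul1r !sub0r => /oppr_inj -> ->.
Qed.

Lemma adjoint_eq T (S : H -> H) : adjoint_pair T S -> adjoint T = S.
Proof.
move=> TS; apply/funext => y; rewrite /adjoint; case: xgetP => [z _ Tz|/(_ (S y))].
  by apply: rdot_inj => x; rewrite -TS /rdot Tz.
case=> /= x. exact: (adjoint_pair_inner T S TS).
Qed.

(** A complex operator with real quadratic form is symmetric. *)
Lemma polarization T (S : H -> H) : adjoint_pair T S ->
  (forall x, rdot (T x) ('i%C *: x) = 0) -> T =1 S.
Proof.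
move=> TS T0 x; apply: rdot_inj => y; rewrite -TS (rdotC y).
(* The cross terms at x + y would pair [T x] with i y; shifting by i y instead
   makes the factors i cancel. *)
have := T0 (x + 'i%C *: y).
rewrite !linearD /= !linearZ_LR /= !rdotE !T0 iiE !rdotNr !rdot_il iiE rdotNr.
have := T0 y; rewrite /= (rdotC (T y) x); lra.
Qed.


Lemma adjoint_pairC (T S : H -> H) : adjoint_pair T S -> adjoint_pair S T.
Proof. by move=> TS x y; rewrite rdotC -TS rdotC. Qed.

(** * Positive forms *)

(** Stated for the semi-inner product of a positive operator, because it is
applied both to <Ax, y> and to the inner product itself. *)
Lemma cauchy_schwarz A : adjoint_pair A A -> (forall x, 0 <= rdot (A x) x) ->
  forall x y, rdot (A x) y ^+ 2 <= rdot (A x) x * rdot (A y) y.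
Proof.
move=> Asym A_ge0 x y.
have quad t : 0 <= rdot (A x) x + t * (2 * rdot (A x) y) + t ^+ 2 * rdot (A y) y.
  have := A_ge0 (x + t%:C%C *: y).
  rewrite linearD linearZ_LR /= !rdotE (Asym y x) (rdotC y (A x)).
  by congr (_ <= _); ring.
have [y0|y0] := eqVneq (rdot (A y) y) 0.
  have : 2 * rdot (A x) y = 0.
    apply: (@linear_bound_eq0 _ 0 _ (rdot (A x) x)) => m.
    by have := quad m; rewrite y0; lra.
  move=> /eqP; rewrite mulf_eq0 pnatr_eq0 /= => /eqP ->.
  by rewrite y0 mulr0 expr0n.
have {}y0 : 0 < rdot (A y) y by rewrite lt0r y0 A_ge0.
have := quad (- rdot (A x) y / rdot (A y) y).
have -> : rdot (A x) x + - rdot (A x) y / rdot (A y) y * (2 * rdot (A x) y) +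
    (- rdot (A x) y / rdot (A y) y) ^+ 2 * rdot (A y) y
  = (rdot (A x) x * rdot (A y) y - rdot (A x) y ^+ 2) / rdot (A y) y.
  by field; rewrite gt_eqF.
by rewrite pmulr_lge0 ?invr_gt0 // subr_ge0.
Qed.

Lemma rdot_cauchy_schwarz x y : rdot x y ^+ 2 <= nrm2 x * nrm2 y.
Proof. by apply: (cauchy_schwarz idfun) => // z; exact: nrm2_ge0. Qed.

Lemma form_bound A a : 0 <= a -> (forall x, nrm2 (A x) <= a ^+ 2 * nrm2 x) ->
  forall x, rdot (A x) x <= a * nrm2 x.
Proof.
move=> a0 Abnd x; have [h|/ltW h] := leP (rdot (A x) x) 0.
  by apply: (le_trans h); rewrite mulr_ge0 ?nrm2_ge0.
rewrite -(@ler_pXn2r _ 2) ?nnegrE ?mulr_ge0 ?nrm2_ge0 //.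
apply: (le_trans (rdot_cauchy_schwarz _ _)).
by rewrite exprMn [X in _ <= _ * X]expr2 mulrA ler_wpM2r ?nrm2_ge0.
Qed.

(** This is A^2 <= a A, which follows from Cauchy-Schwarz for <Ax, y>
at the vectors [x] and [A x]. It makes [A] continuous from the seminorm of
<Ax, x> to the norm. *)
Lemma positive_bound A a : adjoint_pair A A -> (forall x, 0 <= rdot (A x) x) ->
  0 <= a -> (forall x, nrm2 (A x) <= a ^+ 2 * nrm2 x) ->
  forall x, nrm2 (A x) <= a * rdot (A x) x.
Proof.
move=> Asym A_ge0 a0 Abnd x.
have [x0|x0] := eqVneq (nrm2 (A x)) 0; first by rewrite x0 mulr_ge0.
have {}x0 : 0 < nrm2 (A x) by rewrite lt0r x0 nrm2_ge0.
rewrite -(ler_pM2r x0) -expr2.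
apply: (le_trans (cauchy_schwarz A Asym A_ge0 x (A x))).
by rewrite mulrAC mulrC ler_wpM2r ?form_bound.
Qed.

(** * Growth of iterates *)

(** This is T - i mu, with the scalar split so that its real factor passes
through the real bilinear form [rdot]. *)
Definition shift (mu : R) (T : H -> H) x := T x - mu%:C%C *: ('i%C *: x).

(** Hyponormality survives an imaginary shift: both cross terms equal
-2 mu Im<Tx, x>. *)
Lemma hyponormal_shift T S mu x : adjoint_pair T S ->
  nrm2 (S x) <= nrm2 (T x) -> nrm2 (shift (- mu) S x) <= nrm2 (shift mu T x).
Proof.
move=> TS hyp.
have cross : rdot (S x) ('i%C *: x) = - rdot (T x) ('i%C *: x).
  by rewrite (adjoint_pairC _ _ TS) linearZ_LR /= (rdotC x) rdot_il.
rewrite /nrm2 /shift !rdotE !(rdotC ('i%C *: x)) cross.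
by move: hyp; rewrite /nrm2; lra.
Qed.

Lemma shift_adjoint T S mu : adjoint_pair T S ->
  adjoint_pair (shift mu T) (shift (- mu) S).
Proof.
by move=> TS x y; rewrite /shift !rdotE TS rdot_il; ring.
Qed.

(** For W = T - i mu, hyponormality bounds |W^* W x| by |W^2 x| in
|W x|^2 = <x, W^* W x>. *)
Lemma hyponormal_log_convex T S mu : adjoint_pair T S ->
  (forall x, nrm2 (S x) <= nrm2 (T x)) -> forall x,
  nrm2 (shift mu T x) ^+ 2 <= nrm2 x * nrm2 (shift mu T (shift mu T x)).
Proof.
move=> TS hyp x; rewrite {1}/nrm2 (shift_adjoint T S mu TS).
apply: (le_trans (rdot_cauchy_schwarz _ _)).
by apply: ler_wpM2l; [exact: nrm2_ge0 | exact: hyponormal_shift].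
Qed.

(** For the form <Ax, y> the operator [S] is symmetric, so
S - i mu satisfies the Pythagorean identity
|(S - i mu)x|^2 = |Sx|^2 + mu^2 |x|^2, with |x|^2 standing for <Ax, x>. *)
Lemma symmetrizable_growth A S (r mu : R) : adjoint_pair (A \o S) (A \o S) ->
  adjoint_pair A A ->
  (forall x, rdot (A (S x)) (S x) <= r * rdot (A x) x) -> forall x,
  rdot (A (shift mu S x)) (shift mu S x) <= (r + mu ^+ 2) * rdot (A x) x.
Proof.
move=> ASsym Asym Sbnd x.
have cross : rdot (A (S x)) ('i%C *: x) = 0.
  have := ASsym x ('i%C *: x); rewrite /= !linearZ_LR /= (rdotC x) rdot_il; lra.
rewrite /shift linearB /= !(linearZ_LR A) /= !rdotE cross !rdot_il iiE !rdotNr.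
have -> : rdot (A x) ('i%C *: S x) = 0.
  by rewrite -[LHS]opprK -rdot_il -linearZ_LR Asym rdotC cross oppr0.
by have := Sbnd x; lra.
Qed.

(** The estimate |(T - i mu)y|^2 <= (r + mu^2) |y|^2 at y = K x, valid for
all real mu of either sign, leaves no room for an imaginary part of <Ty, y>.
The operator [K] transfers the growth bound from the seminorm to the norm. *)
Lemma intertwined_real A K T S (r C : R) :
  adjoint_pair A A -> adjoint_pair (A \o S) (A \o S) -> 0 < r ->
  (forall x, rdot (A (S x)) (S x) <= r * rdot (A x) x) ->
  0 <= C -> (forall x, nrm2 (K x) <= C * rdot (A x) x) ->
  (forall mu x, nrm2 (shift mu T x) ^+ 2 <=
     nrm2 x * nrm2 (shift mu T (shift mu T x))) ->
  (forall x, T (K x) = K (S x)) ->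
  forall x, rdot (T (K x)) ('i%C *: K x) = 0.
Proof.
move=> Asym ASsym r0 Sbnd C0 Kbnd Tconv TK x.
pose u mu n := iter n (shift mu T) (K x).
pose v mu n := iter n (shift mu S) x.
have uv mu n : u mu n = K (v mu n).
  elim: n => // n IH; rewrite /u iterS -/(u mu n) IH /v iterS -/(v mu n) /shift TK.
  by rewrite linearB /= !(linearZ_LR K).
have rmu mu : 0 < r + mu ^+ 2 by rewrite ltr_pwDl ?sqr_ge0.
have vbnd mu n :
    rdot (A (v mu n)) (v mu n) <= rdot (A x) x * (r + mu ^+ 2) ^+ n.
  elim: n => [|n IH]; first by rewrite mulr1.
  apply: (le_trans (symmetrizable_growth A S r mu ASsym Asym Sbnd _)).
  by rewrite (exprS (r + _)) mulrCA ler_wpM2l // ltW.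
have step mu : nrm2 (shift mu T (K x)) <= (r + mu ^+ 2) * nrm2 (K x).
  apply: (@log_convex_growth _ (fun n => nrm2 (u mu n)) (C * rdot (A x) x)) => //=.
    by move=> n; exact: nrm2_ge0.
  by move=> n; rewrite uv; apply: (le_trans (Kbnd _)); rewrite -mulrA ler_wpM2l.
have : 2 * rdot (T (K x)) ('i%C *: K x) = 0.
  apply: (@linear_bound_eq0 _ (nrm2 (T (K x))) _ (r * nrm2 (K x))) => mu.
  have := step mu; rewrite /nrm2 /shift !rdotE (rdotC ('i%C *: _) (T _)).
  by rewrite !rdot_il iiE rdotNr; lra.
by move/eqP; rewrite mulf_eq0 pnatr_eq0 /= => /eqP.
Qed.

(** Relative to the closure of the range of [T] and its complement, the kernel
of [S], the operator [T] has block rows (T11, T12) and (0, 0).  The hypothesis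
makes T11 self-adjoint, and the comparison of norms then forces T12 = 0. *)
Lemma hyponormal_selfadjoint T S : adjoint_pair T S ->
  (forall x, nrm2 (S x) <= nrm2 (T x)) ->
  (forall x, rdot (T (T x)) ('i%C *: T x) = 0) -> T =1 S.
Proof.
move=> TS hyp real; have ST := adjoint_pairC _ _ TS.
(* <STTx, x> = <TTx, Tx> is real, so STT is symmetric. *)
have STT x : S (T (T x)) = S (S (T x)).
  apply: (polarization (S \o (T \o T)) (S \o (S \o T))) => [y z|y] /=.
    by rewrite ST !TS.
  by rewrite ST linearZ_LR real.
(* The vector X below is orthogonal to the range of [T], which contains T (T x).
   Hence |S (T x)|^2 = |T (T x)|^2 + |X|^2. *)
have TT x : T (T x) = S (T x).
  pose X := T (T x) - S (T x).
  have SX : S X = 0 by rewrite linearB /= STT subrr.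
  apply/eqP; rewrite -subr_eq0; apply/eqP/nrm2_eq0; rewrite -/X.
  apply/eqP; rewrite eq_le nrm2_ge0 andbT.
  have TX : rdot (T (T x)) X = 0 by rewrite TS SX rdot0r.
  have STE : S (T x) = T (T x) - X by rewrite opprB addrC subrK.
  have := hyp (T x); rewrite STE; clearbody X.
  by rewrite {1}/nrm2 !rdotE (rdotC X) TX /nrm2; lra.
move=> x; apply/eqP; rewrite -subr_eq0; apply/eqP/nrm2_eq0.
(* The kernel of [S] contains w, and there T T = S T gives
   |Tw|^2 = <Sw, Tw> = 0: this is the vanishing of T12. *)
have [w wE] : {w | w = T x - S x} by exists (T x - S x).
have Sw : S w = 0.
  by apply: rdot_inj => z; rewrite -TS wE !rdotE -ST -!TS TT subrr rdot0r.
have Tw : T w = 0.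
  by apply: nrm2_eq0; rewrite /nrm2 TS -TT -ST Sw rdot0l.
by rewrite -wE /nrm2 {2}wE !rdotE -ST Sw -TS Tw subrr.
Qed.

End RealInnerProduct.

(** * The corollary *)

Theorem corollary1p9 (R : realType) (H : hilbertType R)
    (H_separable : separable H) (H_infinite : ~ finite_dimensional H)
    (A B : {linear H -> H})
    (A_bounded : bounded_operator A) (B_bounded : bounded_operator B)
    (A_positive : positive A) (B_self_adjoint : self_adjoint B) :
  hyponormal (A \o B) \/ hyponormal (B \o A) ->
  normal (A \+ 'i%C \*: B).
Proof.
have A_ge0 x : 0 <= rdot (A x) x.
  by have := A_positive x; rewrite /rdot lecE /= => /andP[].
have Asym : adjoint_pair A A.
  have AA : adjoint_pair A (adjoint A).
    by move=> x y; rewrite /rdot (adjointP A_bounded).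
  move=> x y; rewrite AA (polarization _ _ AA) // => z.
  have := A_positive z; rewrite rdotC /rdot innerZl (innerC z) lecE /=.
  case: (inner (A z) z) => a b /= /andP[/eqP -> _].
  by rewrite mul0r mul1r oppr0 subrr.
have Bsym : adjoint_pair B B.
  by move=> x y; rewrite /rdot (adjointP B_bounded) B_self_adjoint.
have [m m0 Abnd] := bounded_nrm2 A A_bounded.
have [b b0 Bbnd] := bounded_nrm2 B B_bounded.
pose a := Num.sqrt m; have a0 : 0 <= a by exact: sqrtr_ge0.
have {}Abnd x : nrm2 (A x) <= a ^+ 2 * nrm2 x by rewrite sqr_sqrtr.
have Abnd' := positive_bound A a Asym A_ge0 a0 Abnd.
have ABA : adjoint_pair (A \o (B \o A)) (A \o (B \o A)).
  by move=> x y /=; rewrite Asym Bsym Asym.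
have pAB : adjoint_pair (A \o B) (B \o A) by move=> x y /=; rewrite Asym Bsym.
have pBA := adjoint_pairC _ _ pAB.
have BAbnd x : nrm2 (B (A x)) <= b * a * rdot (A x) x.
  by apply: (le_trans (Bbnd _)); rewrite -mulrA ler_wpM2l.
(* Adding 1 keeps [r] positive even when [A] or [B] is zero. *)
pose r := a * (b * a) + 1.
have r0 : 0 < r by rewrite ltr_wpDl ?mulr_ge0.
have Sbnd x : rdot (A (B (A x))) (B (A x)) <= r * rdot (A x) x.
  apply: (le_trans (form_bound A a a0 Abnd _)).
  apply: (le_trans (ler_wpM2l a0 (BAbnd x))).
  by rewrite mulrA ler_wpM2r // lerDl.
(* The two cases take (K, T) = (A, AB) and (BA, BA).  The values on the range of
   [T] are K (B x) in the first and K x in the second. *)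
move=> AB_hyp; have comm : (A \o B) =1 (B \o A).
  case: AB_hyp => hyp.
    have {}hyp x : nrm2 (B (A x)) <= nrm2 (A (B x)).
      by have := hyp x; rewrite (adjoint_eq _ _ pAB) le_nrm2.
    apply: (hyponormal_selfadjoint (A \o B) (B \o A)) => // x.
    apply: (intertwined_real A A (A \o B) (B \o A) r a Asym ABA r0 Sbnd) => //.
    by move=> mu; apply: (hyponormal_log_convex _ _ _ pAB).
  have {}hyp x : nrm2 (A (B x)) <= nrm2 (B (A x)).
    by have := hyp x; rewrite (adjoint_eq _ _ pBA) le_nrm2.
  move=> x; apply/esym; move: x.
  apply: (hyponormal_selfadjoint (B \o A) (A \o B)) => // x.
  apply: (intertwined_real A (B \o A) (B \o A) (B \o A) r (b * a) Asym ABA r0 Sbnd) => //.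
    by rewrite mulr_ge0.
  by move=> mu; apply: (hyponormal_log_convex _ _ _ pBA).
have Nadj : adjoint_pair (A \+ 'i%C \*: B) (A \- 'i%C \*: B).
  by move=> x y /=; rewrite !rdotE Asym rdot_il Bsym linearZ_LR.
rewrite /normal (adjoint_eq _ _ Nadj); apply/funext => x /=.
have ABx : A (B x) = B (A x) := comm x.
by rewrite !linearB !linearD /= (linearZ_LR A) /= ABx !addrA subrK addrK.
Qed.
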